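(* Let $K_{n_1,n_2,\dots,n_r}$ be a complete $r$-partite graph that is connected and has at least three vertices, with $r$ vertex classes $X_i$ ($1\le i\le r$), $|X_i|=n_i$ and $\sum_{i=1}^{r}n_i=n$. Then (i) $\mathrm{fgndi}_{\sum}(K_{n_1,n_2,\dots,n_r})=1$ if $n_1<n_2<\dots<n_r$; and (ii) $\mathrm{fgndi}_{\sum}(K_{n_1,n_2,\dots,n_r})\leq 3$ if $n_1=n_2=\dots=n_r=\frac{n}{r}$.
   Context: The complete $r$-partite graph $K_{n_1,\dots,n_r}$ has vertex set the disjoint union of the nonempty classes $X_1,\dots,X_r$, two vertices being adjacent if and only if they lie in different classes. For a finite simple graph $G$ and an integer $k\ge 1$, a non-proper total $k$-coloring is an arbitrary map $f: V(G)\cup E(G)\rightarrow \{1,2,\dots,k\}$. Its weight function is $$\phi(x)=f(x)+\sum_{e\ni x}f(e)+\sum_{y\in N(x)}f(y)\quad (x\in V(G)),$$ where the first sum is over the edges $e$ incident with $x$ and $N(x)=\{y\in V(G): xy\in E(G)\}$. The coloring $f$ is called a neighbor full sum distinguishing (NFSD) total $k$-coloring if $\phi(x)\neq\phi(y)$ for every edge $xy\in E(G)$. The neighbor full sum distinguishing total chromatic number $\mathrm{fgndi}_{\sum}(G)$ is the smallest $k$ for which $G$ has an NFSD total $k$-coloring. *)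

(* Defs.v *)
From mathcomp Require Import all_boot.

Set Implicit Arguments.
Unset Strict Implicit.
Unset Printing Implicit Defensive.

Record sgraph := SGraph {
  vertex :> finType;
  adj : rel vertex;
  adj_sym : symmetric adj;
  adj_irr : irreflexive adj }.

Definition connected (G : sgraph) : Prop :=
  forall x y : G, connect (@adj G) x y.

Definition edges (G : sgraph) : {set {set G}} :=
  [set e | [exists x : G, [exists y : G, adj x y && (e == [set x; y])]]].

Definition edge (G : sgraph) : finType := {e : {set G} | e \in edges G}.

(* The domain V(G) + E(G) is a disjoint sum: [inl x] is a vertex, [inr e] an
   edge. The colours are the actual integers 1, ..., k. *)
Definition total_coloring (G : sgraph) (k : nat) (f : G + edge G -> nat) : Prop :=
  forall z, 1 <= f z <= k.

Definition weight (G : sgraph) (f : G + edge G -> nat) (x : G) : nat :=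
  f (inl x) + \sum_(e : edge G | x \in val e) f (inr e)
            + \sum_(y : G | adj x y) f (inl y).

Definition NFSD_coloring (G : sgraph) (k : nat) (f : G + edge G -> nat) : Prop :=
  total_coloring k f /\ forall x y : G, adj x y -> weight f x <> weight f y.

Definition NFSD_colorable (G : sgraph) (k : nat) : Prop :=
  0 < k /\ exists f : G + edge G -> nat, NFSD_coloring k f.

(* [is_fgndi G k]: the neighbor full sum distinguishing total chromatic number
   of G exists and equals k. It is a relation because some graphs, such as K_2,
   have no NFSD total coloring at all. *)
Definition is_fgndi (G : sgraph) (k : nat) : Prop :=
  NFSD_colorable G k /\ forall j, NFSD_colorable G j -> k <= j.

Section CompleteMultipartite.
Variables (r : nat) (n : 'I_r -> nat).

(* The class X_i is the i-th summand 'I_(n i) of this disjoint union. *)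
Definition multipartite_vertex : finType := {i : 'I_r & 'I_(n i)}.

Definition multipartite_adj : rel multipartite_vertex :=
  fun u v => tag u != tag v.

Lemma multipartite_adj_sym : symmetric multipartite_adj.
Proof. by move=> u v; rewrite /multipartite_adj eq_sym. Qed.

Lemma multipartite_adj_irr : irreflexive multipartite_adj.
Proof. by move=> u; rewrite /multipartite_adj eqxx. Qed.

Definition complete_multipartite : sgraph :=
  SGraph multipartite_adj_sym multipartite_adj_irr.

End CompleteMultipartite.

(* Main.v *)
Require Import Defs.
From mathcomp Require Import all_boot.
From mathcomp Require Import zify.

Set Implicit Arguments.
Unset Strict Implicit.
Unset Printing Implicit Defensive.

(** Colour the vertices and edges of the complete multipartite graph by class
    only: a vertex of X_i gets d i and an edge between X_i and X_j gets
    c (i + j).  All vertices of X_i then have the same weight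
      W i = d i + \sum_(j != i) n_j * (c (i + j) + d j)
    ([weight_class_coloring]), and the colouring is NFSD as soon as W is
    injective on the classes.

    For classes of distinct sizes, c = d = 1 makes W i = 1 + 2 (N - n_i), which
    determines n_i.

    For r classes of the same size m, let h = r./2, let c s be 1, 2 or 3
    according as s <, = or > 2h, let d 0 = 2 and d i = 1 for i > 0.  Passing from
    class a to class a + 1 shifts the window a, ..., a + r - 1 of arguments of c
    by one, so the sum of c over the window grows by c (a + r) - c a.  The
    missing term j = i costs c (2a + 2) - c (2a) in this growth, at most 1
    because 2h is even: c cannot jump twice between two consecutive even
    numbers.  As 2h is r or r - 1, the window gains 2 unless r is even and
    a = 0, where it gains 1; in that case the loss is 0 unless r = 2.  So the
    edge colours alone separate the classes when r >= 3.  The larger colour on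
    the vertices of X_0 takes care of r = 2, in which m >= 2: it moves W 1 - W 0
    up by m - 1 ([balanced_weight_step]).

    The chromatic number exists once some colouring does, since colourability
    with k colours is decidable ([fgndi_exists]). *)

Section ChromaticNumber.
Variable G : sgraph.

(** Colourings with values in 1, ..., k form a finite type, which makes
    colourability a boolean property and provides a least k. *)
Definition NFSD_colorableb (k : nat) : bool :=
  (0 < k) && [exists f : {ffun G + edge G -> 'I_k.+1},
    [forall z, 0 < f z] &&
    [forall x, forall y, adj x y ==>
       (weight (fun z => val (f z)) x != weight (fun z => val (f z)) y)]].

Lemma NFSD_colorableP (k : nat) :
  reflect (NFSD_colorable G k) (NFSD_colorableb k).
Proof.
apply: (iffP andP) => [[k0 /existsP[f /andP[/forallP f0 /forallP fP]]]|].
  split=> //; exists (fun z => val (f z)); split=> [z|x y xy].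
    by rewrite f0 -ltnS ltn_ord.
  by apply/eqP; move/forallP/(_ y): (fP x); rewrite xy.
case=> k0 [f [fk fP]]; split=> //.
pose g : {ffun G + edge G -> 'I_k.+1} := [ffun z => inord (f z)].
have gE z : g z = f z :> nat.
  by rewrite ffunE inordK // ltnS; case/andP: (fk z).
have wE x : weight (fun z => val (g z)) x = weight f x.
  by rewrite /weight /= gE; congr (_ + _ + _); apply: eq_bigr => *; rewrite gE.
apply/existsP; exists g; apply/andP; split.
  by apply/forallP=> z; rewrite gE; case/andP: (fk z).
apply/forallP=> x; apply/forallP=> y; apply/implyP=> xy.
by rewrite !wE; apply/eqP/fP.
Qed.

Lemma fgndi_exists (k : nat) :
  NFSD_colorable G k -> exists l, is_fgndi G l /\ l <= k.
Proof.
move=> /NFSD_colorableP kP.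
case: (ex_minnP (ex_intro NFSD_colorableb k kP)) => l /NFSD_colorableP lP lmin.
exists l; split; last exact: lmin.
by split=> // j /NFSD_colorableP; apply: lmin.
Qed.

(** The map y |-> {x, y} is a bijection from the neighbours of x onto the edges
    at x. *)
Lemma sum_incident_edges (F : {set G} -> nat) (x : G) :
  \sum_(e : edge G | x \in val e) F (val e) = \sum_(y | adj x y) F [set x; y].
Proof.
have set2_inj : {in [set y | adj x y] &, injective (fun y => [set x; y])}.
  move=> y z; rewrite !inE => xy _ /setP/(_ y); rewrite !inE eqxx orbT.
  case/esym/orP => /eqP // yx.
  by rewrite yx adj_irr in xy.
rewrite -(big_sub_cond (edges G) (fun e => x \in e) F).
transitivity (\sum_(e in [set [set x; y] | y in [set y | adj x y]]) F e).
  apply: eq_bigl => e; apply/andP/imsetP => [[]|[y]]; rewrite inE.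
    case/existsP=> u /existsP[v /andP[uv /eqP->]].
    rewrite !inE => /orP[]/eqP->; first by exists v; rewrite ?inE.
    by exists u; rewrite ?inE 1?adj_sym // setUC.
  move=> xy ->; split; last by rewrite !inE eqxx.
  rewrite inE; apply/existsP; exists x; apply/existsP; exists y.
  by rewrite xy eqxx.
by rewrite big_imset //=; apply: eq_bigl => y; rewrite inE.
Qed.

End ChromaticNumber.

Section ClassColoring.
Variables (r : nat) (n : 'I_r -> nat).
Let K := complete_multipartite n.

Lemma sum_by_class (P : pred 'I_r) (F : 'I_r -> nat) :
  \sum_(y : K | P (tag y)) F (tag y) = \sum_(j | P j) n j * F j.
Proof.
transitivity (\sum_(j | P j) \sum_(a : 'I_(n j)) F j); last first.
  by apply: eq_bigr => j _; rewrite sum_nat_const card_ord.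
by rewrite sig_big_dep; apply: eq_bigl => y; rewrite andbT.
Qed.

(** An edge is an unordered pair, so the index sum of its two classes is
    expressed as the sum over its elements. *)
Definition class_coloring (c d : nat -> nat) (z : K + edge K) : nat :=
  match z with
  | inl v => d (tag v)
  | inr e => c (\sum_(u in val e) tag u)
  end.

Lemma weight_class_coloring (c d : nat -> nat) (x : K) :
  weight (class_coloring c d) x =
    d (tag x) + \sum_(j | j != tag x) n j * (c (tag x + j) + d j).
Proof.
rewrite /weight /=.
rewrite (sum_incident_edges (fun e : {set K} => c (\sum_(u in e) tag u))).
rewrite -addnA -big_split /= -(sum_by_class _ (fun j => c (tag x + j) + d j)).
congr (_ + _); apply: eq_big => [y|y xy]; first by rewrite eq_sym.
rewrite big_setU1 ?big_set1 // inE.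
by apply: contraNneq xy => ->.
Qed.

Lemma class_coloring_NFSD (k : nat) (c d : nat -> nat) :
    0 < k -> (forall s, 1 <= c s <= k) -> (forall s, 1 <= d s <= k) ->
    injective (fun i : 'I_r =>
      d i + \sum_(j | j != i) n j * (c (i + j) + d j)) ->
  NFSD_colorable K k.
Proof.
move=> k0 cP dP W_inj; split=> //; exists (class_coloring c d).
split=> [[v|e] /=|x y xy]; [exact: dP|exact: cP|].
rewrite !weight_class_coloring => /W_inj xy_eq.
by move: xy; rewrite /adj /= /multipartite_adj xy_eq eqxx.
Qed.

Lemma card_complete_multipartite : #|K| = \sum_(i < r) n i.
Proof.
rewrite -sum1_card (sum_by_class xpredT (fun=> 1)).
by apply: eq_bigr => j _; rewrite muln1.
Qed.

Lemma distinct_sizes_colorable :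
  injective n -> NFSD_colorable K 1.
Proof.
move=> n_inj; apply: (@class_coloring_NFSD 1 (fun=> 1) (fun=> 1)) => // i j /=.
rewrite -!big_distrl /= => W_ij; apply: n_inj.
have total k : \sum_j n j = n k + \sum_(j | j != k) n j by rewrite (bigD1 k).
have := total i; rewrite (total j); move: W_ij.
set si := \sum_(_ | _ != i) _; set sj := \sum_(_ | _ != j) _; lia.
Qed.

End ClassColoring.

Section Balanced.
Variable r : nat.

Definition edge_color (s : nat) : nat := 1 + (r./2.*2 <= s) + (r./2.*2 < s).

Definition vertex_color (a : nat) : nat := 1 + (a == 0).

Definition balanced_weight (m a : nat) : nat :=
  vertex_color a +
  \sum_(0 <= b < r | b != a) m * (edge_color (a + b) + vertex_color b).

Lemma window_shift (c : nat -> nat) (a : nat) :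
  \sum_(0 <= b < r) c (a.+1 + b) + c a = \sum_(0 <= b < r) c (a + b) + c (a + r).
Proof.
rewrite -(big_nat_recr r 0 (fun b => c (a + b))) //= big_nat_recl //=.
by rewrite addn0 addnC; congr (_ + _); apply: eq_bigr => b _; rewrite addSnnS.
Qed.

(** Let A a be the sum of the colours seen from class a, own colour excluded.
    Then A (a + 1) - A a is at least 1, and at least 2 if a = 0 and r > 2: one
    unit comes from the vertex colours when a = 0, the rest from the edge
    colours.  The weight multiplies this by m and loses 1 at a = 0, where the own
    colour drops; the net change is positive because m >= 2 when r = 2. *)
Lemma balanced_weight_step (m a : nat) :
  3 <= r * m -> a.+1 < r -> balanced_weight m a < balanced_weight m a.+1.
Proof.
move=> rm3 ar; rewrite /balanced_weight -!big_distrr /=.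
set A0 := \sum_(0 <= b < r | b != a) _; set A1 := \sum_(0 <= b < r | _) _.
have split_own b : b < r ->
    \sum_(0 <= j < r) edge_color (b + j) + \sum_(0 <= j < r) vertex_color j =
    edge_color (b + b) + vertex_color b +
      \sum_(0 <= j < r | j != b) (edge_color (b + j) + vertex_color j).
  by move=> br; rewrite -big_split /= (bigD1_seq b) ?mem_index_iota ?iota_uniq //=.
have := split_own a (ltnW ar); have := split_own a.+1 ar; rewrite -/A0 -/A1.
have := window_shift edge_color a.
set P0 := \sum_(0 <= b < r) edge_color (a + b).
set P1 := \sum_(0 <= b < r) edge_color (a.+1 + b).
set D := \sum_(0 <= b < r) _ => shift own1 own0.
have m_gt0 : 0 < m by case: (m) rm3; rewrite ?muln0.
have A_step : A0 + 1 + ((a == 0) && (2 < r)) <= A1.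
  move: shift own1 own0; rewrite /edge_color /vertex_color.
  (* The parity of r decides whether 2h is r or r - 1. *)
  have := odd_double_half r; case: (odd r) => /= rE; lia.
rewrite /vertex_color; case: (posnP a) A_step => [->|a_gt0] /=; last first.
  by move=> A_step; have: A0 < A1 by [lia]; rewrite -(ltn_pmul2l m_gt0); lia.
case: (ltngtP 2 r) => r2 A_step; [nia|lia|].
by have: 1 < m by [lia]; nia.
Qed.

Lemma balanced_colorable (m : nat) (n : 'I_r -> nat) :
    (forall i, n i = m) -> 3 <= r * m ->
  NFSD_colorable (complete_multipartite n) 3.
Proof.
move=> nE rm3.
have W_lt (i j : 'I_r) : i < j -> balanced_weight m i < balanced_weight m j.
  case: j => j jr /=; elim: j jr => // j IHj jr; rewrite ltnS leq_eqVlt.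
  have stepj := balanced_weight_step rm3 jr.
  case/predU1P=> [->//|ij]; exact: ltn_trans (IHj (ltnW jr) ij) stepj.
apply: (@class_coloring_NFSD _ _ 3 edge_color vertex_color) => // [s|s|i j /=].
- by rewrite /edge_color; lia.
- by rewrite /vertex_color; lia.
have WE (k : 'I_r) : vertex_color k +
    \sum_(l | l != k) n l * (edge_color (k + l) + vertex_color l) =
    balanced_weight m k.
  rewrite /balanced_weight big_mkord; congr (_ + _).
  by apply: eq_bigr => l _; rewrite nE.
rewrite !WE => W_ij; apply/val_inj.
by case: (ltngtP i j) => // /W_lt; rewrite W_ij ltnn.
Qed.

End Balanced.

Theorem theorem11 (r : nat) (n : 'I_r -> nat) (N : nat)
    (n_gt0 : forall i : 'I_r, 0 < n i)
    (sum_n : \sum_(i < r) n i = N)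
    (K_connected : connected (complete_multipartite n))
    (K_ge3 : 3 <= #|complete_multipartite n|) :
  ((forall i j : 'I_r, i < j -> n i < n j) ->
     is_fgndi (complete_multipartite n) 1) /\
  ((forall i : 'I_r, n i = N %/ r) ->
     exists k : nat, is_fgndi (complete_multipartite n) k /\ k <= 3).
Proof.
split=> [n_incr|n_const].
  split; last by move=> j [].
  apply: distinct_sizes_colorable => i j nij; apply/val_inj.
  by case: (ltngtP i j) => // /n_incr; rewrite nij ltnn.
apply/fgndi_exists/(balanced_colorable n_const).
move: K_ge3; rewrite card_complete_multipartite.
by under eq_bigr do rewrite n_const; rewrite sum_nat_const card_ord.
Qed.
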